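(* Let $R\geq 1$ be an integer and let $\mathbf{h}^1,\dots,\mathbf{h}^R$ be independent random elements of $\mathbb{R}^{S\times K}$, each distributed according to the normal distribution in $\mathbb{R}^{S\times K}$. Then, with probability $1$, $$\dim\left(\mathrm{Span}\left((\mathcal{A}P(\mathbf{h}^r))_{r=1,\dots,R}\right)\right)=\begin{cases}R & \text{if } R\leq \mathrm{rk}(\mathcal{A}),\\ \mathrm{rk}(\mathcal{A}) & \text{otherwise.}\end{cases}$$
   Context: $K\geq 1$, $S\geq 2$ are integers, $[S]=\{1,\dots,S\}$. An element $\mathbf{h}\in\mathbb{R}^{S\times K}$ is a $K$-tuple of vectors $\mathbf{h}_1,\dots,\mathbf{h}_K\in\mathbb{R}^S$ with entries $\mathbf{h}_{k,i}$. $\mathbb{R}^{S^K}$ is the space of real order-$K$ tensors $T=(T_{\mathbf{i}})_{\mathbf{i}\in[S]^K}$. The Segre embedding is $P:\mathbb{R}^{S\times K}\to\mathbb{R}^{S^K}$, $P(\mathbf{h})_{\mathbf{i}}=\mathbf{h}_{1,i_1}\cdots\mathbf{h}_{K,i_K}$. Let $M_k:\mathbb{R}^S\to\mathbb{R}^{m_k\times m_{k+1}}$ ($k=1,\dots,K$, $m_1=m$, $m_{K+1}=n$) be linear maps, and let $\mathcal{A}:\mathbb{R}^{S^K}\to\mathbb{R}^{m\times n}$ be the unique linear map such that $M_1(\mathbf{h}_1)\cdots M_K(\mathbf{h}_K)=\mathcal{A}P(\mathbf{h})$ for all $\mathbf{h}\in\mathbb{R}^{S\times K}$. $\mathrm{rk}(\mathcal{A})$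 is the rank of the linear map $\mathcal{A}$. The normal distribution in $\mathbb{R}^{S\times K}$ is the standard Gaussian one (i.i.d. $N(0,1)$ entries). *)

(* Defs.v *)
From HB Require Import structures.
From mathcomp Require Import all_boot all_order all_algebra.
From mathcomp Require Import all_classical all_reals all_analysis.

Set Implicit Arguments.
Unset Strict Implicit.
Unset Printing Implicit Defensive.

Import Order.TTheory GRing.Theory Num.Theory.
Import numFieldNormedType.Exports.

Local Open Scope classical_set_scope.
Local Open Scope ring_scope.

(* All indices (k, i, and the dimensions m_k) are 0-based.  R^(S x K) is      *)
(* K.-tuple (S.-tuple R), so that it carries the library's product (Borel)    *)
(* sigma-algebra; h_(k,i) is [tnth (tnth h k) i].                             *)
Definition params (R : realType) (S K : nat) := K.-tuple (S.-tuple R).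

Definition param_col (R : realType) (S K : nat) (h : params R S K) (k : 'I_K) :
  'cV[R]_S := \col_(i < S) tnth (tnth h k) i.

(* R^o rather than R, so that tensors form a vectType over R.                 *)
Definition tensor (R : realType) (S K : nat) :=
  {ffun {ffun 'I_K -> 'I_S} -> R^o}.

Definition segre (R : realType) (S K : nat) (h : params R S K) :
  tensor R S K :=
  [ffun i : {ffun 'I_K -> 'I_S} => \prod_(k < K) tnth (tnth h k) (i k)].

Fixpoint mxprod (R : realType) (m : nat -> nat) (K : nat) :
    (forall k : 'I_K, 'M[R]_(m k, m k.+1)) -> 'M[R]_(m 0%N, m K) :=
  match K with
  | 0%N => fun=> 1%:M
  | K'.+1 => fun B =>
      mxprod (fun k : 'I_K' => B (widen_ord (leqnSn K') k)) *m B ord_max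
  end.

Definition entry (R : realType) (S K : nat) (ki : 'I_K * 'I_S)
  (h : params R S K) : R := tnth (tnth h ki.1) ki.2.

Lemma measurable_entry (R : realType) (S K : nat) (ki : 'I_K * 'I_S) :
  measurable_fun [set: params R S K] (entry ki).
Proof.
by apply: (@measurableT_comp _ _ _ _ _ _ (fun t => tnth t ki.2) _
  (fun h : params R S K => tnth h ki.1)); exact: measurable_tnth.
Qed.

HB.instance Definition _ (R : realType) (S K : nat) (ki : 'I_K * 'I_S) :=
  isMeasurableFun.Build _ _ _ _ (@entry R S K ki) (@measurable_entry R S K ki).

Definition mutually_independent d d' (T : measurableType d)
    (T' : measurableType d') (R : realType) (P : probability T R)
    (I : finType) (X : I -> {RV P >-> T'}) : Prop :=
  forall (J : {set I}) (B : I -> set T'),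
    (forall i, i \in J -> measurable (B i)) ->
    P (\bigcap_(i in [set` J]) X i @^-1` B i) =
    (\prod_(i in J) P (X i @^-1` B i))%E.

(* Equality is required on measurable sets only: off the sigma-algebra both   *)
(* sides have junk values.                                                    *)
Definition has_law d d' (T : measurableType d) (T' : measurableType d')
    (R : realType) (P : probability T R) (X : {RV P >-> T'})
    (mu : set T' -> \bar R) : Prop :=
  forall B, measurable B -> distribution P X B = mu B.

Definition standard_normal d (T : measurableType d) (R : realType)
    (P : probability T R) (S K : nat) (h : {RV P >-> params R S K}) : Prop :=
  let X (ki : 'I_K * 'I_S) : {RV P >-> R} := entry ki \o h in
  mutually_independent X /\ forall ki, has_law (X ki) (normal_prob 0 1).

(* Main.v *)
Require Import Defs.
From HB Require Import structures.
From mathcomp Require Import all_boot all_order all_algebra.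
From mathcomp Require Import all_classical all_reals all_analysis.
From mathcomp Require Import measurable_realfun ring.

Set Implicit Arguments.
Unset Strict Implicit.
Unset Printing Implicit Defensive.

Import Order.TTheory GRing.Theory Num.Theory.
Import numFieldNormedType.Exports.

Local Open Scope classical_set_scope.
Local Open Scope ring_scope.

(* Put n := min(N, rk A).  Rank-one tensors span the tensor space, so n of     *)
(* their images under A form a free family B.  The determinant of the          *)
(* B-coordinates of A P(h^1), ..., A P(h^n) is affine in each scalar entry of  *)
(* each h^r separately, and it is nonzero when A P(h^r) = B_r.  A nonzero      *)
(* function a(x') + x_i b(x') of this kind vanishes with probability 0, by     *)
(* induction on the number of variables and Fubini: almost surely b(x') is     *)
(* nonzero (unless b = 0 identically, in which case a is nonzero), and then    *)
(* only one value of x_i, which is independent of x', gives 0.                 *)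

(** The upper bound is deterministic: the span is generated by [N] vectors and lies in [limg A]. For
    the lower bound it suffices that the first [n] images are almost surely free.
    [det_coord_mx_neq0] derives this from the nonvanishing of one determinant, which is affine in
    every entry ([det_coord_mx_multiaffine]) and not identically zero ([exists_det_coord_mx_neq0]).
    [multiaffine_null] shows that such a function of independent atomless variables vanishes with
    probability 0; it rests on [independent_cylinders] and [null_of_null_sections].
    [mutually_independent_pair] supplies the joint independence of all scalar entries of all
    samples. *)

Section independence.
Context d (T : measurableType d) (R : realType) (P : probability T R).
Context d' (T' : measurableType d') (I : finType) (X : I -> {RV P >-> T'}).

(** A pi-system generating the sigma-algebra of the variables indexed by [J]. *)
Definition cylinders (J : {set I}) : set (set T) :=
  [set \bigcap_(i in [set` J]) X i @^-1` B i | B in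
    [set B : I -> set T' | forall i, measurable (B i)]].

Lemma measurable_preimage_RV i (B : set T') :
  measurable B -> measurable (X i @^-1` B).
Proof. by move=> mB; rewrite -[X in measurable X]setTI; exact: measurable_funP. Qed.

Lemma measurable_cylinders J : cylinders J `<=` measurable.
Proof.
move=> _ [B mB <-]; apply: fin_bigcap_measurable => // i _.
exact: measurable_preimage_RV.
Qed.

Lemma cylindersT J : cylinders J setT.
Proof. by exists (fun=> setT) => //=; apply/seteqP; split. Qed.

Lemma setI_closed_cylinders J : setI_closed (cylinders J).
Proof.
move=> _ _ [B mB <-] [C mC <-]; exists (fun i => B i `&` C i).
  by move=> i; exact: measurableI.
by rewrite -bigcapI.
Qed.

Lemma cylinders_preimage (J : {set I}) i (B : set T') : i \in J -> measurable B ->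
  cylinders J (X i @^-1` B).
Proof.
move=> iJ mB; exists (fun k => if k == i then B else setT).
  by move=> k /=; case: ifP.
apply/seteqP; split => [w /(_ i iJ)|w XiB k _] /=; first by rewrite eqxx.
by case: eqP => [->|].
Qed.

Hypothesis indepX : mutually_independent X.

(** Both sides are finite measures in [E]. They agree on the pi-system of cylinders by mutual
    independence, hence on the sigma-algebra it generates. *)
Lemma independent_cylinders (J : {set I}) j E (C : set T') :
  j \notin J -> measurable C -> <<s cylinders J >> E ->
  P (E `&` X j @^-1` C) = (P E * P (X j @^-1` C))%E.
Proof.
move=> jJ mC sE.
have mXC : measurable (X j @^-1` C) by exact: measurable_preimage_RV.
have PC0 : 0 <= fine (P (X j @^-1` C)) by rewrite fine_ge0.
pose m1 : {measure set T -> \bar R} := mrestr P mXC.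
pose m2 : {measure set T -> \bar R} := mscale (NngNum PC0) P.
suff : m1 E = m2 E.
  by rewrite /m1 /m2 /= /mrestr /mscale /= fineK ?fin_num_measure// muleC.
apply: (@g_sigma_algebra_measure_unique _ _ _ (cylinders J) _ (fun=> setT)) => //.
- exact: measurable_cylinders.
- by move=> _; exact: cylindersT.
- by rewrite bigcup_const.
- exact: setI_closed_cylinders.
- move=> _ [B mB <-].
  rewrite /m1 /m2 /= /mrestr /mscale /= fineK ?fin_num_measure//.
  (* Placing [C] at the index [j] turns the intersection into one cylinder over [j |: J], to which
     the hypothesis applies. *)
  pose B' k := if k == j then C else B k.
  have mB' k : measurable (B' k) by rewrite /B'; case: ifP.
  have B'J k : k \in J -> B' k = B k.
    by move=> kJ; rewrite /B'; case: eqP kJ jJ => // -> ->.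
  have B'j : B' j = C by rewrite /B' eqxx.
  have := indepX (J := j |: J) (fun k _ => mB' k).
  rewrite big_setU1//= B'j.
  have -> : \bigcap_(i in [set` j |: J]) X i @^-1` B' i =
      \bigcap_(i in [set` J]) X i @^-1` B i `&` X j @^-1` C.
    apply/seteqP; split => w /=.
      move=> h; split; last by have := h j; rewrite /= setU11 B'j; apply.
      by move=> k /= kJ; have := h k; rewrite /= finset.setU1r// B'J//; apply.
    move=> [h1 h2] k /=; rewrite finset.in_setU1 => /predU1P[->|kJ].
      by rewrite B'j.
    by rewrite B'J//; exact: h1.
  move=> ->; congr (_ * _)%E.
  rewrite (eq_bigr (fun i => P (X i @^-1` B i))); last first.
    by move=> i iJ; rewrite B'J.
  by rewrite -(indepX (J := J) (fun k _ => mB k)).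
- by move=> _; rewrite /m1 /= /mrestr setTI ltey_eq fin_num_measure.
Qed.

End independence.

(** * Fubini for null sets, and absence of atoms *)

(** By independence the law of (Y, X) is the product of the marginal laws, so the probability is the
    integral over y of the mass of the section of [A] at y. The integrand vanishes off the null set
    [N]. *)
Lemma null_of_null_sections d (T : measurableType d) (R : realType)
    (P : probability T R) d1 (T1 : measurableType d1) d2
    (T2 : measurableType d2) (Y : T -> T1) (X : T -> T2)
    (mY : measurable_fun setT Y) (mX : measurable_fun setT X)
    (A : set (T1 * T2)) (N : set T1) :
  (forall B C, measurable B -> measurable C ->
    P (Y @^-1` B `&` X @^-1` C) = (P (Y @^-1` B) * P (X @^-1` C))%E) ->
  measurable A -> measurable N -> P (Y @^-1` N) = 0%E ->
  (forall y, ~ N y -> P (X @^-1` xsection A y) = 0%E) ->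
  P [set w | A (Y w, X w)] = 0%E.
Proof.
move=> indep mA mN PN0 PA0.
pose YX w := (Y w, X w).
have mYX : measurable_fun setT YX by exact: measurable_fun_pair.
pose X' : {RV P >-> T2} := mfun_Sub (mem_set mX).
pose Y' : {RV P >-> T1} := mfun_Sub (mem_set mY).
pose YX' : {RV P >-> (T1 * T2)%type} := mfun_Sub (mem_set mYX).
have := @product_measure_unique _ _ _ _ _ (distribution P Y') (distribution P X')
  (distribution P YX') indep A mA.
move=> H; rewrite -[LHS]/(P (YX @^-1` A)) -[LHS]H.
rewrite /product_measure1.
rewrite (ge0_negligible_integral (N := N))//.
- by rewrite setTD integral0_eq// => y /= Ny; exact: PA0.
- exact: (measurable_fun_xsection (distribution P X')).
Qed.

Lemma normal_prob_set1 (R : realType) (x : R) : normal_prob 0 1 [set x] = 0%E.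
Proof.
have /null_content_dominatesP := @normal_prob_dominates R 0 1.
by apply => //; exact: lebesgue_measure_set1.
Qed.

(** * Multiaffine functions and their zero sets *)

Section multiaffine.
Context (R : realType) (I : finType).
Implicit Types (x : I -> R) (f : (I -> R) -> R) (s : seq I).

Definition upd x i t : I -> R := fun k => if k == i then t else x k.

Definition affine_in f i := forall x t,
  f (upd x i t) = f (upd x i 0) + t * (f (upd x i 1) - f (upd x i 0)).

(** The list [s] contains every variable on which [f] may depend. The domain stays the full
    [I -> R], so an induction on [s] removes variables without changing types. *)
Definition multiaffine s f :=
  (forall x y, {in s, x =1 y} -> f x = f y) /\ {in s, forall i, affine_in f i}.

Definition intercept f i x := f (upd x i 0).
Definition slope f i x := f (upd x i 1) - f (upd x i 0).

Lemma upd_id x i : upd x i (x i) = x.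
Proof. by apply/funext => k; rewrite /upd; case: eqP => [->|]. Qed.

Lemma updC x i k t u : i != k -> upd (upd x i t) k u = upd (upd x k u) i t.
Proof.
move=> ik; apply/funext => l; rewrite /upd.
by case: (eqVneq l k) => [->|//]; rewrite eq_sym (negbTE ik).
Qed.

Lemma affine_inE f i x :
  affine_in f i -> f x = intercept f i x + x i * slope f i x.
Proof. by move=> /(_ x (x i)); rewrite upd_id. Qed.

Lemma multiaffine_intercept i s f : i \notin s ->
  multiaffine (i :: s) f -> multiaffine s (intercept f i).
Proof.
move=> iNs [fE fA]; split => [x y xy|k ks x t].
  apply: fE => k; rewrite inE /upd; case: eqP => //= _; exact: xy.
have ki : k != i by apply: contraNneq iNs => <-.
by rewrite /intercept !(updC _ _ _ ki); apply: fA; rewrite inE ks orbT.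
Qed.

Lemma multiaffine_slope i s f : i \notin s ->
  multiaffine (i :: s) f -> multiaffine s (slope f i).
Proof.
move=> iNs [fE fA]; split => [x y xy|k ks x t].
  by rewrite /slope; congr (_ - _); apply: fE => k; rewrite inE /upd;
    case: eqP => //= _; exact: xy.
have ki : k != i by apply: contraNneq iNs => <-.
have kis : k \in i :: s by rewrite inE ks orbT.
rewrite /slope !(updC _ _ _ ki) (fA k kis (upd x i 1)) (fA k kis (upd x i 0)).
by ring.
Qed.

Lemma measurable_multiaffine d (T : measurableType d) (X : I -> T -> R) s f :
  uniq s -> {in s, forall i, measurable_fun setT (X i)} -> multiaffine s f ->
  measurable_fun setT (fun w => f (X ^~ w)).
Proof.
elim: s f => [|i s IHs] f /= => [_ _ [fE _]|/andP[iNs us] mX fM].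
  rewrite (_ : (fun _ => _) = cst (f (fun=> 0))); first exact: measurable_cst.
  by apply/funext => w /=; exact: fE.
have mXs : {in s, forall k, measurable_fun setT (X k)}.
  by move=> k ks; apply: mX; rewrite inE ks orbT.
have -> : (fun w => f (X ^~ w)) = (fun w => intercept f i (X ^~ w)) \+
    (fun w => X i w * slope f i (X ^~ w)).
  by apply/funext => w /=; rewrite -affine_inE//; apply: fM.2; exact: mem_head.
apply: measurable_funD; first exact: IHs (multiaffine_intercept iNs fM).
apply: measurable_funM; first by apply: mX; exact: mem_head.
exact: IHs (multiaffine_slope iNs fM).
Qed.

Context d (T : measurableType d) (P : probability T R).
Context (X : I -> {RV P >-> R}) (indepX : mutually_independent X).
Hypothesis X0 : forall i t, P (X i @^-1` [set t]) = 0%E.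

(** Induction on [s], splitting off x_i: f = intercept + x_i * slope. If the slope is identically 0,
    [f] is its intercept. Otherwise the slope is almost surely nonzero by induction, and then a
    single value of x_i annihilates [f]. *)
Lemma multiaffine_null s f : uniq s -> multiaffine s f ->
  (exists x, f x != 0) -> P [set w | f (X ^~ w) = 0] = 0%E.
Proof.
elim: s f => [|i s IHs] f /=.
  move=> _ [fE _] [x fx0]; rewrite (_ : [set _ | _] = set0) ?measure0//.
  by apply/seteqP; split => // w /= /eqP; rewrite (fE _ x)// (negbTE fx0).
move=> /andP[iNs us] fM [x fx0].
have fAi : affine_in f i by apply: fM.2; exact: mem_head.
have [bx0|b0] := pselect (exists x, slope f i x != 0); last first.
  have bE y : slope f i y = 0.
    by apply/eqP; apply: contrapT => /negP by0; apply: b0; exists y.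
  have fE y : f y = intercept f i y by rewrite (affine_inE _ fAi) bE mulr0 addr0.
  under [X in P X]eq_set do rewrite fE.
  apply: IHs => //; first exact: multiaffine_intercept.
  by exists x; rewrite -fE.
have {}bx0 := IHs _ us (multiaffine_slope iNs fM) bx0.
pose J := [set k in s]%SET.
(* [T1] is [T] with the coarser sigma-algebra of the remaining variables. The identity from [T] to
   [T1] thus plays the part of the random vector of these variables. *)
pose T1 := g_sigma_algebraType (cylinders X J).
have mX1 : {in s, forall k, measurable_fun setT (X k : T1 -> R)}.
  move=> k ks _ B mB; rewrite setTI; apply: sub_sigma_algebra.
  by apply: cylinders_preimage => //; rewrite inE.
have ma := measurable_multiaffine us mX1 (multiaffine_intercept iNs fM).
have mb := measurable_multiaffine us mX1 (multiaffine_slope iNs fM).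
have mXi : measurable_fun setT (X i) by [].
have mid : measurable_fun setT (id : T -> T1).
  move=> _ B mB; rewrite setTI.
  by apply: (smallest_sub (@sigma_algebra_measurable _ T)) mB;
    exact: measurable_cylinders.
pose h (p : T1 * R) := intercept f i (X ^~ p.1) + p.2 * slope f i (X ^~ p.1).
have mh : measurable_fun setT h.
  apply: measurable_funD; first exact: (measurableT_comp ma measurable_fst).
  apply: measurable_funM; first exact: measurable_snd.
  exact: (measurableT_comp mb measurable_fst).
have -> : [set w | f (X ^~ w) = 0] = [set w | (h @^-1` [set 0]) (w, X i w)].
  by apply/seteqP; split => w /=; rewrite /h /= -affine_inE.
apply: (null_of_null_sections mid mXi
  (N := [set w | slope f i (X ^~ w) = 0] : set T1)) => //.
- move=> B C mB mC; apply: (independent_cylinders indepX (J := J)) => //.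
  by rewrite inE.
- by rewrite -[X in measurable X]setTI; exact: mh.
- have -> : [set w | slope f i (X ^~ w) = 0] =
      setT `&` (fun w : T1 => slope f i (X ^~ w)) @^-1` [set 0].
    by rewrite setTI.
  exact: mb.
(* With nonzero slope the section is the single root -intercept/slope, a null event for [X i]. *)
- move=> y; rewrite /= => by0; rewrite [X in P X](_ : _ =
      X i @^-1` [set - intercept f i (X ^~ y) / slope f i (X ^~ y)]) ?X0//.
  have {}by0 : slope f i (X ^~ y) != 0 by exact/eqP.
  apply/seteqP; split => w /=; rewrite /xsection /= inE /h /=.
    move=> /eqP; rewrite addrC addr_eq0 => /eqP <-.
    by rewrite mulfK.
  by move=> ->; rewrite divfK// subrr.
Qed.
End multiaffine.

(** * Independence on two levels *)

(** Group the conditions by their first index [i]: those on [h i] form the single event that [h i]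
    lies in [Br i]. Independence of the [h i] factors over [i], then independence of the components
    factors over [l]. *)
Lemma mutually_independent_pair d (T : measurableType d) (R : realType)
    (P : probability T R) d1 (T1 : measurableType d1) d2
    (T2 : measurableType d2) (I L : finType) (h : I -> {RV P >-> T1})
    (e : L -> {mfun T1 >-> T2}) :
  mutually_independent h ->
  (forall i, mutually_independent (fun l => e l \o h i : {RV P >-> T2})) ->
  mutually_independent (fun p : I * L => e p.2 \o h p.1 : {RV P >-> T2}).
Proof.
move=> indh inde J B mB.
pose Jr i : {set L} := [set l | (i, l) \in J]%SET.
pose Br i := \bigcap_(l in [set` Jr i]) e l @^-1` B (i, l).
have mBr i : measurable (Br i).
  apply: fin_bigcap_measurable => // l /=; rewrite finset.in_set => ilJ.
  rewrite -[X in measurable X]setTI; apply: measurable_funP => //; exact: mB.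
have -> : \bigcap_(p in [set` J]) (e p.2 \o h p.1) @^-1` B p =
    \bigcap_(i in [set` [set: I]%SET]) h i @^-1` Br i.
  apply/seteqP; split => w hw.
    move=> i _ l /=; rewrite finset.in_set => ilJ; exact: (hw (i, l)).
  by move=> [i l] ilJ; apply: (hw i); rewrite /= finset.in_set.
rewrite indh//; under eq_bigr => i _.
  rewrite preimage_bigcap.
  rewrite (inde i (Jr i) (fun l => B (i, l))); last first.
    by move=> l; rewrite finset.in_set => /mB.
  over.
rewrite pair_big_dep/=; apply: eq_big => [[i l]|[i l] _]//=.
by rewrite !finset.in_set.
Qed.

(** * Linear algebra of Segre tensors *)

Lemma exists_basis_subset (F : fieldType) (vT : vectType F) (X : seq vT) :
  exists2 Y : seq vT, {subset Y <= X} & basis_of <<X>>%VS Y.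
Proof.
elim: X => [|v X [Y YX bY]].
  by exists [::] => //; rewrite basisEfree span_nil nil_free subvv dimv0.
have [vX|vX] := boolP (v \in <<X>>%VS).
  exists Y; first by move=> y /YX yX; rewrite inE yX orbT.
  rewrite span_cons; suff -> : (<[v]> + <<X>> = <<X>>)%VS by [].
  by apply/addv_idPr; rewrite -memvE.
exists (v :: Y).
  by move=> y; rewrite !inE => /predU1P[->|/YX ->]; rewrite ?eqxx ?orbT.
rewrite /basis_of free_cons !span_cons (span_basis bY) vX (basis_free bY).
by rewrite eqxx.
Qed.

Section segre_multiaffine.
Context (R : realType) (S K : nat).
Implicit Types (x : 'I_K * 'I_S -> R).

Definition params_of x : params R S K :=
  [tuple [tuple x (k, i) | i < S] | k < K].

Lemma params_ofE (h : params R S K) : params_of (fun ki => entry ki h) = h.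
Proof.
apply: eq_from_tnth => k; apply: eq_from_tnth => i.
by rewrite !tnth_mktuple.
Qed.

(** Each entry of the tensor has exactly one factor from column [ki.1], so it is affine in the
    variable [ki]. The weights 1 - t and t are the form that multilinearity of the determinant takes
    as input. *)
Lemma segre_upd x ki t : segre (params_of (upd x ki t)) =
  (1 - t) *: segre (params_of (upd x ki 0)) +
  t *: segre (params_of (upd x ki 1)).
Proof.
apply/ffunP => i; rewrite !ffunE.
have E u : \prod_(k < K) tnth (tnth (params_of (upd x ki u)) k) (i k) =
    upd x ki u (ki.1, i ki.1) * \prod_(k < K | k != ki.1) x (k, i k).
  rewrite (bigD1 ki.1)//= !tnth_mktuple; congr (_ * _).
  apply: eq_bigr => k kk; rewrite !tnth_mktuple /upd; case: eqP => // e.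
  by rewrite -e eqxx in kk.
rewrite !E /upd /GRing.scale/=; case: ifP => _; ring.
Qed.

(** The Segre image of a tuple of standard basis vectors is a standard basis tensor, and these
    tensors span the whole space. *)
Lemma limg_segre (vT : vectType R) (A : 'Hom(tensor R S K, vT)) :
  limg A = <<[seq A (segre (params_of (fun ki => (i ki.1 == ki.2)%:R)))
    | i : {ffun 'I_K -> 'I_S}]>>%VS.
Proof.
apply/eqP; rewrite eqEsubv; apply/andP; split; last first.
  by apply/span_subvP => _ /mapP[i _ ->]; rewrite memv_img ?memvf.
apply/subvP => _ /memv_imgP[t _ ->].
have -> : t = \sum_(i : {ffun 'I_K -> 'I_S})
    t i *: segre (params_of (fun ki => (i ki.1 == ki.2)%:R)).
  apply/ffunP => j; rewrite sum_ffunE (bigD1 j)//= big1 ?addr0.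
    rewrite !ffunE big1 ?/GRing.scale/= ?mulr1// => k _.
    by rewrite !tnth_mktuple eqxx.
  move=> i ij; rewrite !ffunE.
  have [k ijk] : exists k, i k != j k.
    apply/existsP; apply: contraNT ij; rewrite negb_exists => /forallP ij.
    by apply/eqP/ffunP => k; apply/eqP; rewrite -[_ == _]negbK.
  by rewrite (bigD1 k)//= !tnth_mktuple (negbTE ijk) mul0r /GRing.scale/= mulr0.
rewrite linear_sum rpred_sum// => i _; rewrite linearZ memvZ//.
by apply: memv_span; apply: map_f; rewrite mem_enum.
Qed.

End segre_multiaffine.

(** * The coordinate determinant *)

Section coordinate_determinant.
Context (R : realType) (S K : nat) (vT : vectType R).
Context (A : 'Hom(tensor R S K, vT)) (n N : nat) (leNn : (n <= N)%N).
Context (B : n.-tuple vT).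
Implicit Types (x : 'I_N * ('I_K * 'I_S) -> R).

(** Only the first [n] of the [N] samples enter, which makes the matrix square. *)
Definition coord_mx x : 'M[R]_n := \matrix_(r, i)
  coord B i (A (segre (params_of (fun ki => x (widen_ord leNn r, ki))))).

Lemma coord_mx_upd x r i ki t : widen_ord leNn r != ki.1 ->
  coord_mx (upd x ki t) r i = coord_mx x r i.
Proof.
move=> rk; rewrite !mxE.
congr (coord _ _ (A (segre (params_of _)))); apply/funext => l.
by rewrite /upd; case: eqP => // e; rewrite -e eqxx in rk.
Qed.

(** A variable of sample [r0] occurs only in row [r0], where it enters affinely, and the determinant
    is linear in that row. If [r0] is not among the first [n] samples, the determinant does not
    depend on it. *)
Lemma det_coord_mx_multiaffine s :
  (forall p, p \in s) -> multiaffine s (fun x => \det (coord_mx x)).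
Proof.
move=> s_all; split=> [x y xy|[r0 ki] _ x t].
  by congr (\det (coord_mx _)); apply/funext => p; exact: xy.
have [/existsP[r /eqP rE]|noR] := boolP [exists r, widen_ord leNn r == r0].
  have otherE u r' i : coord_mx (upd x (r0, ki) u) (lift r r') i =
      coord_mx (upd x (r0, ki) t) (lift r r') i.
    have rr' : widen_ord leNn (lift r r') != (r0, ki).1.
      by rewrite -rE -val_eqE [_ == _](val_eqE (lift r r') r) eq_sym neq_lift.
    exact: etrans (coord_mx_upd x i u rr') (esym (coord_mx_upd x i t rr')).
  rewrite (@determinant_multilinear _ _ _ (coord_mx (upd x (r0, ki) 0))
    (coord_mx (upd x (r0, ki) 1)) r (1 - t) t); first by ring.
  - apply/rowP => i; rewrite !mxE.
    have updE u : (fun l => upd x (r0, ki) u (widen_ord leNn r, l)) =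
        upd (fun l => x (r0, l)) ki u.
      by apply/funext => l; rewrite /upd rE xpair_eqE eqxx.
    by rewrite !updE segre_upd !linearD !linearZ.
  - by apply/matrixP => r' i; rewrite [LHS]mxE [RHS]mxE otherE.
  - by apply/matrixP => r' i; rewrite [LHS]mxE [RHS]mxE otherE.
have E u : coord_mx (upd x (r0, ki) u) = coord_mx x.
  apply/matrixP => r i; rewrite coord_mx_upd//.
  by move: noR; rewrite negb_exists => /forallP.
by rewrite !E subrr mulr0 addr0.
Qed.

(** A linear relation among the vectors, read in coordinates, is a row vector killed by the
    invertible matrix. Linearity of [coord] is enough here, so [B] may be any tuple. *)
Lemma det_coord_mx_neq0 x : \det (coord_mx x) != 0 ->
  free [seq A (segre (params_of (fun ki => x (widen_ord leNn r, ki))))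
    | r : 'I_n].
Proof.
move=> det0; set v := fun r => A (segre _).
have -> : [seq v r | r : 'I_n] = [tuple v r | r < n] by [].
apply/freeP => k k0 r.
have uM : coord_mx x \in unitmx by rewrite unitmxE unitfE.
suff : \row_i k i = 0 by move=> /rowP/(_ r); rewrite !mxE.
apply: (row_free_inj (A := coord_mx x)); first by rewrite row_free_unit.
rewrite mul0mx; apply/rowP => i; rewrite !mxE.
move: k0 => /(congr1 (coord B i)); rewrite linear0 linear_sum/=.
apply: etrans.
apply: eq_bigr => j _; rewrite [coord_mx x j i]mxE [X in X * _]mxE linearZ.
by rewrite (nth_map j) ?size_enum_ord// nth_ord_enum.
Qed.

End coordinate_determinant.

(** [B] is taken free among the images of the standard basis tensors. Sampling at the parameters of
    these tensors gives the identity matrix. *)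
Lemma exists_det_coord_mx_neq0 (R : realType) (S K : nat) (vT : vectType R)
    (A : 'Hom(tensor R S K, vT)) (n N : nat) (leNn : (n <= N)%N) :
  (n <= \dim (limg A))%N ->
  exists (B : n.-tuple vT) x, \det (coord_mx A leNn B x) != 0.
Proof.
move=> nA.
have [Y0 YA] := exists_basis_subset [seq A (segre (params_of (fun ki =>
  (i ki.1 == ki.2)%:R))) | i : {ffun 'I_K -> 'I_S}].
rewrite -limg_segre => bY.
have szB : size (take n Y0) == n.
  by rewrite size_takel// -(eqP (basis_free bY)) (span_basis bY).
pose B := Tuple szB.
have freeB : free B.
  by apply: (@catl_free _ _ (drop n Y0)); rewrite cat_take_drop (basis_free bY).
have /choice[g gB] : forall r : 'I_N, exists g : 'I_K * 'I_S -> R,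
    (r < n)%N -> A (segre (params_of g)) = B`_r.
  (* Samples beyond the first [n] get the arbitrary value 0, since they do not enter the matrix. *)
  move=> r; have [rn|] := ltnP r n; last by move=> _; exists (fun=> 0).
  have /mem_take/YA/mapP[i _ ->] : B`_r \in take n Y0.
    by rewrite mem_nth// (eqP szB).
  by eexists.
exists B, (fun p => g p.1 p.2).
suff -> : coord_mx A leNn B (fun p => g p.1 p.2) = 1%:M.
  by rewrite det1 oner_eq0.
by apply/matrixP => r i; rewrite !mxE gB//= coord_free.
Qed.

(** * The dimension of the span *)

Theorem proposition5p3 (R : realType) (K S : nat) (hK : (1 <= K)%N)
    (hS : (2 <= S)%N) (m : nat -> nat)
    (M : forall k : 'I_K, {linear 'cV[R]_S -> 'M[R]_(m k, m k.+1)})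
    (A : 'Hom(tensor R S K, 'M[R]_(m 0%N, m K)))
    (hA : forall h : params R S K,
      mxprod (fun k => M k (param_col h k)) = A (segre h))
    (N : nat) (hN : (1 <= N)%N)
    (d : measure_display) (T : measurableType d) (P : probability T R)
    (h : 'I_N -> {RV P >-> params R S K})
    (h_indep : mutually_independent h)
    (h_normal : forall r, standard_normal (h r)) :
  {ae P, forall w,
    \dim <<[seq A (segre (h r w)) | r : 'I_N]>>%VS =
    (if (N <= \dim (limg A))%N then N else \dim (limg A))%N}.
Proof.
set n := (if _ then _ else _).
have nN : (n <= N)%N by rewrite /n; case: ifPn => //; rewrite -ltnNge => /ltnW.
have nA : (n <= \dim (limg A))%N by rewrite /n; case: ifPn.
have [B detB] := exists_det_coord_mx_neq0 nN nA.
pose f x := \det (coord_mx A nN B x).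
pose X (p : 'I_N * ('I_K * 'I_S)) : {RV P >-> R} := entry p.2 \o h p.1.
have fM : multiaffine (enum {: 'I_N * ('I_K * 'I_S)}) f.
  by apply: det_coord_mx_multiaffine => p; rewrite mem_enum.
have indX : mutually_independent X.
  by apply: mutually_independent_pair => // r; have [] := h_normal r.
have X0 p t : P (X p @^-1` [set t]) = 0%E.
  have [_ law] := h_normal p.1.
  by rewrite -[RHS](normal_prob_set1 t) -(law p.2 _ (measurable_set1 t)).
(* The exceptional null set is the zero set of the determinant. *)
exists [set w | f (X ^~ w) = 0]; split.
- have mX : {in enum {: 'I_N * ('I_K * 'I_S)}, forall p,
      measurable_fun setT (X p)} by [].
  have mf := measurable_multiaffine (enum_uniq _) mX fM.
  by have := mf measurableT _ (measurable_set1 0); rewrite setTI.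
- exact: (multiaffine_null indX X0 (enum_uniq _) fM).
- move=> w; apply: contra_notP => /eqP fw.
  have hE r : h r w = params_of (fun ki => X (r, ki) w) by rewrite -[LHS]params_ofE.
  apply/eqP; rewrite eqn_leq; apply/andP; split.
    have dA : (\dim <<[seq A (segre (h r w)) | r : 'I_N]>>%VS <= \dim (limg A))%N.
      apply: dimvS; apply/span_subvP => _ /mapP[r _ ->].
      by rewrite memv_img ?memvf.
    rewrite /n; case: ifPn => // _.
    by apply: leq_trans (dim_span _) _; rewrite size_map size_enum_ord.
  (* Lower bound: the first [n] images are free, and their span lies in that of all [N]. *)
  have /eqP := det_coord_mx_neq0 fw; rewrite size_map size_enum_ord => <-.
  apply: dimvS; apply/span_subvP => _ /mapP[r _ ->].
  by rewrite -hE; apply: memv_span; apply: map_f; rewrite mem_enum.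
Qed.
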